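(* Let $H$ and $K$ be two complex inner product spaces with $\dim(H)\geq 2$, and let $A : H\to K$ be a non-zero mapping with dense image. Then the following statements are equivalent: (a) $A$ is a (complex) linear or conjugate-linear mapping and there exists $\gamma >0$ such that $\| A (x) \| = \gamma \|x\|$ for all $x\in H$, that is, $A$ is a positive scalar multiple of a linear or a conjugate-linear isometry; (b) There exists $\gamma_1 >0$ such that one of the following properties holds: (b.1) $\langle A(x) |A(y)\rangle = \gamma_1 \langle x|y\rangle$ for all $x,y\in H$; or (b.2) $\langle A(x) |A(y)\rangle = \gamma_1 \langle y|x \rangle$ for all $x,y \in H$; (c) $A$ is linear or conjugate-linear and preserves orthogonality in both directions; (d) $A$ is linear or conjugate-linear and preserves orthogonality; (e) $A$ is additive and preserves orthogonality in both directions; (f) $A$ is additive and preserves orthogonality.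
   Context: Inner product spaces are not assumed to be complete; the inner product is denoted $\langle\cdot|\cdot\rangle$, is linear in the first variable and conjugate-linear in the second, and $\|x\|=\sqrt{\langle x|x\rangle}$. $\dim(H)$ is the dimension of $H$ as a complex vector space. ''Linear'' means complex-linear. Elements $x,y$ of a complex inner product space are orthogonal, written $x\perp_2 y$, if $\langle x|y\rangle=0$. A mapping $A:H\to K$ preserves orthogonality if for all $x,y\in H$, $x\perp_2 y$ implies $A(x)\perp_2 A(y)$; it preserves orthogonality in both directions if for all $x,y\in H$, $x\perp_2 y$ if and only if $A(x)\perp_2 A(y)$. $A$ is additive if $A(x+y)=A(x)+A(y)$ for all $x,y\in H$. $A$ has dense image if $A(H)$ is norm-dense in $K$. *)

(* Defs.v *)
From mathcomp Require Export all_boot all_order all_algebra.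
From mathcomp Require Export complex.
From mathcomp Require Export classical_sets cardinality reals.

Set Implicit Arguments.
Unset Strict Implicit.
Unset Printing Implicit Defensive.

Import Order.TTheory GRing.Theory Num.Theory.

Local Open Scope classical_set_scope.
Local Open Scope card_scope.
Local Open Scope ring_scope.
Local Open Scope complex_scope.

(* A complex inner product space is an [lmodType R[i]] (R : realType) with an
   inner product of type [{dot H for Num.conj}]: a positive definite hermitian
   form, linear in its first argument and conjugate-linear in its second. No
   completeness is assumed. *)

(** Dimension of a vector space that need not be of finite dimension *)

Section Dimension.
Variables (F : fieldType) (V : lmodType F).

Definition lin_indep (B : set V) : Prop :=
  forall (s : seq V) (c : V -> F), uniq s -> [set` s] `<=` B ->
    \sum_(v <- s) c v *: v = 0 -> forall v, v \in s -> c v = 0.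

Definition spanning (B : set V) : Prop :=
  forall x : V, exists (s : seq V) (c : V -> F),
    [set` s] `<=` B /\ x = \sum_(v <- s) c v *: v.

Definition hamel_basis (B : set V) : Prop := lin_indep B /\ spanning B.

Definition dim_ge (n : nat) : Prop :=
  exists B : set V, hamel_basis B /\ `I_n #<= B.

End Dimension.

Arguments dim_ge {F} V n.

Section InnerProduct.
Variables (R : realType) (H : lmodType R[i]) (ip : {dot H for Num.conj}).

(* The norm is a nonnegative real number, seen as an element of R[i]. *)
Definition ipnorm (x : H) : R[i] := sqrtC (ip x x).

Definition orth (x y : H) : Prop := ip x y = 0.

End InnerProduct.

Section Maps.
Variables (R : realType) (H K : lmodType R[i]).
Variables (ipH : {dot H for Num.conj}) (ipK : {dot K for Num.conj}).
Variable A : H -> K.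

Definition additive_map : Prop := {morph A : x y / x + y}.

Definition conj_linear : Prop := GRing.linear_for (Num.conj \; *:%R) A.

Definition preserves_orth : Prop :=
  forall x y : H, orth ipH x y -> orth ipK (A x) (A y).

Definition preserves_orth_both : Prop :=
  forall x y : H, orth ipH x y <-> orth ipK (A x) (A y).

Definition dense_image : Prop :=
  forall (y : K) (e : R), 0 < e -> exists x : H, ipnorm ipK (A x - y) < e%:C.

End Maps.

(* Main.v *)
Require Import Defs.
From mathcomp Require Import all_boot all_order all_algebra complex reals.
From mathcomp Require Import ring lra.
From mathcomp Require Import functions.
From HB Require Import structures.

Set Implicit Arguments.
Unset Strict Implicit.
Unset Printing Implicit Defensive.

Import Order.TTheory GRing.Theory Num.Theory.
Local Open Scope classical_set_scope.
Local Open Scope complex_scope.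
Local Open Scope ring_scope.

(** The idea is to show that an additive map preserving orthogonality changes
    the inner product only through a scalar function, to compute that function,
    and to use the density of the image at the very end.

    If [u = a w + c e] and [v = b w + e] with [e] and [w] orthogonal, then [u]
    and [v] are orthogonal as soon as [a b^* |w|^2 + c |e|^2 = 0]; in
    [<A u | A v> = 0] the mixed terms vanish, and
    [<A (a w) | A (b w)>] is thereby expressed through the line of [e]
    ([orth_transfer]). In dimension at least two every line can be compared with
    that of [e], which gives an additive [f : C -> C] such that
    [<A u | A v> = f <u | v>] for all [u], [v] ([ip_additive_factor]).

    No continuity has been assumed, but [|A u + i A (i u)|^2 >= 0] and
    [|A u - i A (i u)|^2 >= 0] say that [t |-> f t + i f (i t)] and
    [t |-> f t - i f (i t)] are nonnegative on the nonnegative reals, and an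
    additive function with this property is real-linear
    ([additive_ge0_linear]). Hence [f z = q z + p z^*] with [p, q >= 0]
    ([ip_split]): [A] is the sum of its linear part [(A u - i A (i u)) / 2],
    which scales the norm by [sqrt q], and of its conjugate-linear part
    [(A u + i A (i u)) / 2], which scales it by [sqrt p], and the images of the
    two parts are orthogonal. If [p] and [q] were both nonzero, the value
    of the linear part at a nonzero [e] would lie at a positive distance from
    the image of [A] ([dense_split]); so [A] multiplies the inner product by a constant, up to
    conjugation ([orth_additive_similarity]).

    The rest is formal: such an [A] is linear or conjugate-linear because the
    defect [A (a u + v) - a A u - A v] has norm zero ([similarity_linear],
    [similarity_conj_linear]), and conversely a norm identity gives back the
    inner product by polarization ([norm_similarity]). *)

(** * Two tools on scalar-valued functions *)

(** The order on [R[i]] only compares numbers with the same imaginary part, so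
    nonnegativity makes [phi] real-valued and monotone. Squeezing [n t] between
    consecutive integers then bounds [n |phi t - t phi 1|] by [phi 1] for every
    [n], and [R] is archimedean. *)
Lemma additive_ge0_linear (R : realType) (phi : R -> R[i]) :
  {morph phi : s t / s + t} -> (forall t, 0 <= t -> 0 <= phi t) ->
  forall t, phi t = t%:C * phi 1.
Proof.
move=> phiD phi_ge0 t.
have phi0 : phi 0 = 0 by apply: (addrI (phi 0)); rewrite -phiD !addr0.
have phiB s r : phi (s - r) = phi s - phi r.
  by apply/eqP; rewrite eq_sym subr_eq -phiD subrK.
pose psi (s : R) : R := complex.Re (phi s).
have psiB s r : psi (s - r) = psi s - psi r by rewrite /psi phiB raddfB.
pose h : {additive R -> R} :=
  HB.pack psi (GRing.isZmodMorphism.Build R R psi psiB).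
have h_ge0 s : 0 <= s -> 0 <= h s.
  by move/phi_ge0; rewrite lecE => /andP[].
have h_le s r : s <= r -> h s <= h r.
  by move=> sr; rewrite -subr_ge0 -raddfB h_ge0 // subr_ge0.
have phiE s : phi s = (h s)%:C.
  suff /RRe_real <- : phi s \is Num.real by [].
  have pos r : 0 <= r -> phi r \is Num.real by move/phi_ge0/ger0_real.
  have [/pos//|/ltW s_le0] := leP 0 s.
  rewrite -[s]opprK -[- - s]sub0r phiB phi0 sub0r realN pos // oppr_ge0 //.
suff -> : phi t = (t * h 1)%:C by rewrite phiE rmorphM.
rewrite phiE; congr _%:C; apply/eqP; rewrite -subr_eq0 -normr_eq0.
set d := `|_|; rewrite eq_le normr_ge0 andbT leNgt; apply/negP => d_gt0.
have bound n : n%:R * d <= h 1.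
  have /andP[lo hi] := floor_itv (n%:R * t).
  have hz (k : int) : h k%:~R = k%:~R * h 1 by rewrite raddfMz mulrzl.
  have hn : h (n%:R * t) = n%:R * h t by rewrite !mulr_natl raddfMn.
  move: (h_le _ _ lo) (h_le _ _ (ltW hi)); rewrite !hz hn.
  have h1 := h_ge0 _ ler01.
  rewrite intrD mulrDl mul1r => lo' hi'.
  have lo2 := ler_wpM2r h1 lo; have hi2 := ler_wpM2r h1 (ltW hi).
  rewrite -[n%:R]ger0_norm // -normrM ler_norml.
  move: lo2 hi2; rewrite intrD => lo2 hi2.
  by apply/andP; split; lra.
have := bound (Num.bound (h 1 / d)).
rewrite leNgt -ltr_pdivrMr // archi_boundP // divr_ge0 ?h_ge0 ?ler01 //.
exact: ltW.
Qed.

(** Taking [j] to be ['i] or [- 'i] covers the forms that are linear in either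
    argument and conjugate-linear in the other one. Vanishing on the diagonal
    makes [D] antisymmetric, and comparing [D ('i x) y] with [D y ('i x)] makes
    it symmetric as well. *)
Lemma sesqui_polarization (C : numClosedFieldType) (H : lmodType C)
    (D : H -> H -> C) (j : C) :
  (forall z, {morph D^~ z : x y / x + y}) ->
  (forall z, {morph D z : x y / x + y}) ->
  (forall x y, D ('i *: x) y = j * D x y) ->
  (forall x y, D x ('i *: y) = - j * D x y) ->
  j != 0 -> (forall x, D x x = 0) -> forall x y, D x y = 0.
Proof.
move=> Dl Dr Dil Dir j0 Dd x y.
have skew u v : D u v + D v u = 0.
  by have := Dd (u + v); rewrite Dl !Dr !Dd addr0 add0r.
have := skew ('i *: x) y; rewrite Dil Dir mulNr -mulrBr => /eqP.
rewrite mulf_eq0 (negPf j0) /= subr_eq0 => /eqP eqD.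
have /eqP := skew x y; rewrite -eqD -mulr2n mulrn_eq0 => /eqP //.
Qed.

(** * Inner products *)

Section InnerProductTheory.
Variables (R : realType) (H : lmodType R[i]) (ip : {dot H for Num.conj}).

Lemma ipC u v : ip u v = (ip v u)^*.
Proof. by rewrite hermC expr0 mul1r. Qed.
(** Sesquilinearity is restated with [ip] itself as the head on both sides, so
    that the rules collected in [ipE] can be iterated. *)
Lemma ipZl a u v : ip (a *: u) v = a * ip u v.
Proof. exact: linearZl_LR. Qed.
Lemma ipZr a u v : ip u (a *: v) = a^* * ip u v.
Proof. exact: linearZr_LR. Qed.
Lemma ip_eq0 u : ip u u = 0 -> u = 0.
Proof. by move=> /eqP; rewrite dnorm_eq0 => /eqP. Qed.

Lemma ipDl u v w : ip (u + v) w = ip u w + ip v w.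
Proof. exact: linearDl. Qed.
Lemma ipDr u v w : ip w (u + v) = ip w u + ip w v.
Proof. exact: linearDr. Qed.
Lemma ipBl u v w : ip (u - v) w = ip u w - ip v w.
Proof. exact: linearBl. Qed.
Lemma ipBr u v w : ip w (u - v) = ip w u - ip w v.
Proof. exact: linearBr. Qed.

Definition ipE := (ipBl, ipBr, ipDl, ipDr, ipZl, ipZr).

Lemma ortho_decomp (e x : H) : e != 0 ->
  exists a w, ip w e = 0 /\ x = a *: e + w.
Proof.
move=> e0; have N0 : ip e e != 0 by rewrite dnorm_eq0.
exists (ip x e / ip e e), (x - (ip x e / ip e e) *: e); split.
  by rewrite !ipE divfK // subrr.
by rewrite addrC subrK.
Qed.

(** The second vector is obtained by orthogonalizing two elements of a Hamel
    basis. *)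
Lemma dim2_orth : dim_ge H 2 -> exists e y, [/\ e != 0, y != 0 & ip y e = 0].
Proof.
move=> [B [[Bfree _] /card_leP[f]]].
have I0 : 0%N \in `I_2 by apply: (@mem_set nat).
have I1 : 1%N \in `I_2 by apply: (@mem_set nat).
pose x := f (SigSub I0); pose y := f (SigSub I1).
have xy : val x != val y.
  apply/eqP => /val_inj eq_xy.
  have := 'inj_f _ _ eq_xy.
  by move=> /(_ (mem_set I) (mem_set I)) /(congr1 val).
have free c d : c *: val x + d *: val y = 0 -> c = 0 /\ d = 0.
  move=> cd0.
  pose k v := if v == val x then c else d.
  have ky : k (val y) = d by rewrite /k eq_sym (negPf xy).
  have kx : k (val x) = c by rewrite /k eqxx.
  have := Bfree [:: val x; val y] k.
  rewrite /= inE xy !big_cons big_nil kx ky addr0 => /(_ isT _ cd0) k0.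
  have sB : [set` [:: val x; val y]]%classic `<=` B.
    move=> v /=; rewrite !inE => /orP[] /eqP ->; exact: set_valP.
  by rewrite -kx -ky; split; apply: k0; rewrite // !inE eqxx ?orbT.
have x0 : val x != 0.
  apply/eqP => x0; have [] := free 1 0.
    by rewrite x0 scaler0 scale0r addr0.
  by move/eqP; rewrite oner_eq0.
have [a [w [we yE]]] := ortho_decomp (val y) x0.
exists (val x), w; split=> //; apply/eqP => w0.
have [] := free a (-1); first by rewrite yE w0 addr0 scaleN1r subrr.
by move=> _ /eqP; rewrite oppr_eq0 oner_eq0.
Qed.
End InnerProductTheory.

(** * Additive maps preserving orthogonality act through a scalar function *)

Section Preserver.
Variables (R : realType) (H K : lmodType R[i]).
Variables (ipH : {dot H for Num.conj}) (ipK : {dot K for Num.conj}).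
Variable (A : {additive H -> K}).
Hypothesis A_orth : preserves_orth ipH ipK A.

(** The normalization makes [F e] the scalar function through which [A] acts
    on the line of [e]: [z / <e | e> *: e] has inner product [z]
    with [e]. *)
Let F (e : H) (z : R[i]) : R[i] := ipK (A ((z / ipH e e) *: e)) (A e).

(** The vectors [a w - (c / |e|^2) e] and [b w + e] are orthogonal exactly for
    [c = a b^* |w|^2]; expanding the product of their images gives the
    formula. *)
Lemma orth_transfer (e w : H) a b : e != 0 -> ipH w e = 0 ->
  ipK (A (a *: w)) (A (b *: w)) = F e (a * b^* * ipH w w).
Proof.
move=> e0 we; have N0 : ipH e e != 0 by rewrite dnorm_eq0.
have ew : ipH e w = 0 by rewrite ipC we conjC0.
set c := a * b^* * ipH w w.
have : ipK (A (a *: w - (c / ipH e e) *: e)) (A (b *: w + e)) = 0.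
  apply: A_orth; rewrite /orth !ipE we ew /c; field.
  exact: N0.
rewrite (raddfB A) (raddfD A) !ipE.
rewrite (@A_orth (a *: w) e); last by rewrite /orth !ipE we mulr0.
rewrite (@A_orth ((c / ipH e e) *: e) (b *: w)); last first.
  by rewrite /orth !ipE ew !mulr0.
rewrite addr0 add0r => /eqP; rewrite subr_eq0 => /eqP //.
Qed.

(** The second dimension is what allows a line to be compared with itself: the
    formula of [orth_transfer] is carried from [e] to a vector [y] orthogonal to
    it, and back. *)
Lemma ip_additive_factor : dim_ge H 2 ->
  exists f : R[i] -> R[i], {morph f : z w / z + w} /\
     forall u v, ipK (A u) (A v) = f (ipH u v).
Proof.
move=> /(dim2_orth ipH) [e [y [e0 y0 ye]]].
have N0 : ipH e e != 0 by rewrite dnorm_eq0.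
have M0 : ipH y y != 0 by rewrite dnorm_eq0.
have ey : ipH e y = 0 by rewrite ipC ye conjC0.
have FD : {morph F e : z w / z + w}.
  by move=> z w; rewrite /F mulrDl scalerDl raddfD ipE.
(* The line of e, through a detour by the line of y. *)
have self a b : ipK (A (a *: e)) (A (b *: e)) = F e (a * b^* * ipH e e).
  rewrite (orth_transfer _ _ y0 ey) /F -[X in ipK _ (A X)]scale1r.
  rewrite (orth_transfer _ _ e0 ye) conjC1 mulr1 divfK //.
(* Any line, splitting its direction into components along and across e. *)
have line v a b : ipK (A (a *: v)) (A (b *: v)) = F e (a * b^* * ipH v v).
  have [c [w [we ->]]] := ortho_decomp ipH v e0.
  have ew : ipH e w = 0 by rewrite ipC we conjC0.
  rewrite !scalerDr !scalerA !(raddfD A) !ipE self (orth_transfer _ _ e0 we).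
  rewrite (@A_orth ((a * c) *: e)); last by rewrite /orth !ipE ew !mulr0.
  rewrite (@A_orth (a *: w)); last by rewrite /orth !ipE we !mulr0.
  rewrite addr0 add0r -FD we ew; congr (F e _); rewrite rmorphM /=; ring.
exists (F e); split=> // u v.
have [-> | v0] := eqVneq v 0.
  by rewrite raddf0 !linear0r /F mul0r scale0r raddf0 linear0l.
have [c [w [wv ->]]] := ortho_decomp ipH u v0.
rewrite (raddfD A) !ipE (@A_orth w v) // addr0 wv addr0.
rewrite -[X in ipK _ (A X)]scale1r line.
by rewrite conjC1 mulr1.
Qed.

End Preserver.

(** * Linear and conjugate-linear parts *)

Section Parts.
Variables (R : realType) (H K : lmodType R[i]).
Variables (ipH : {dot H for Num.conj}) (ipK : {dot K for Num.conj}).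
Variable (A : H -> K).

(** Here [P = f 1 + i f i] and [Q = f 1 - i f i] are the real-linear slopes of
    [t |-> |A u + s A (i u)|^2 / 2], for [|u|^2 = t] and [s] equal to ['i]
    and [- 'i]. Since additivity determines [f] from its values on the real and
    the imaginary axis, these two slopes determine [f]. *)
Lemma ip_split (f : R[i] -> R[i]) : (exists e : H, e != 0) ->
  {morph f : z w / z + w} -> (forall u v, ipK (A u) (A v) = f (ipH u v)) ->
  exists p q, [/\ 0 <= p, 0 <= q &
    forall u v, ipK (A u) (A v) = q * ipH u v + p * ipH v u].
Proof.
move=> [e e0] fD fE; have N0 : ipH e e != 0 by rewrite dnorm_eq0.
have f0 : f 0 = 0 by apply: (addrI (f 0)); rewrite -fD !addr0.
have fN z : f (- z) = - f z by apply/eqP; rewrite -addr_eq0 -fD addNr f0.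
have lin (s : R[i]) : s * s^* = 1 -> s^* = - s ->
    0 <= f 1 + s * f 'i /\
    forall t : R, f t%:C + s * f ('i * t%:C) = t%:C * (f 1 + s * f 'i).
  move=> s2 sC; pose phi (t : R) := f t%:C + s * f ('i * t%:C).
  have phiD : {morph phi : t r / t + r}.
    by move=> t r; rewrite /phi rmorphD mulrDr !fD; ring.
  have phi_ge0 t : 0 <= t -> 0 <= phi t.
    move=> t0; have [u uu] : exists u, ipH u u = t%:C.
      exists (sqrtC (t%:C / ipH e e) *: e); rewrite !ipE mulrA geC0_conj.
        by rewrite -expr2 sqrtCK divfK.
      by rewrite sqrtC_ge0 divr_ge0 ?ler0c // dnorm_ge0.
    have := dnorm_ge0 ipK (A u + s *: A ('i *: u)).
    rewrite !ipE !fE !ipE uu conjCi mulNr fN.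
    have -> : 'i * - ('i * t%:C) = t%:C.
      by rewrite mulrN mulrA -expr2 sqrCi mulN1r opprK.
    rewrite [s * (s^* * _)]mulrA s2 sC.
    rewrite (_ : _ + _ = 2 * phi t) ?pmulr_rge0 ?ltr0n //.
    by rewrite /phi; ring.
  have phi1 : phi 1 = f 1 + s * f 'i by rewrite /phi mulr1.
  split=> [|t]; first by rewrite -phi1 phi_ge0 ?ler01.
  by rewrite -phi1 -(additive_ge0_linear phiD).
have [] := lin 'i; rewrite ?conjCi // ?mulrN -?expr2 ?sqrCi ?opprK //.
have [] := lin (- 'i); rewrite ?rmorphN /= ?conjCi ?opprK ?mulNr // -?expr2
  ?sqrCi ?opprK //.
set Q := f 1 - _; set P := f 1 + _ => Q0 Qlin P0 Plin.
exists (P / 2), (Q / 2); split; rewrite ?divr_ge0 ?ler0n //.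
move=> u v; rewrite fE [ipH v u]ipC; set z := ipH u v.
rewrite [z]complexE; set x := complex.Re z; set y := complex.Im z.
rewrite complexiE fD rmorphD rmorphM /= conjCi.
rewrite ![(_%:C)^*]conj_Creal ?complex_real //.
have := Qlin x; have := Plin x; have := Qlin y; have := Plin y.
set fx := f x%:C; set fy := f ('i * y%:C).
set gx := f ('i * x%:C); set gy := f y%:C.
move=> Py Qy Px Qx.
have -> : fx = x%:C * (P + Q) / 2.
  by rewrite mulrDr -Px -Qx mulNr; field.
have ify : 'i * fy = y%:C * (P - Q) / 2.
  by rewrite mulrBr -Py -Qy mulNr; field.
have -> : fy = - 'i * ('i * fy) by rewrite mulrA mulNr -expr2 sqrCi opprK mul1r.
by rewrite ify; field.
Qed.

(** Let [y = (A e - i A (i e)) / 2] be the linear part of [A] at [e]. Since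
    [<y | A v> = q <e | v>] and [|y|^2 = q |e|^2], completing the square gives
    [(p + q) |A v - y|^2 = |(p + q) v - q e|^2 + p q |e|^2], which keeps [y]
    away from the image of [A] unless [p q = 0]. *)
Lemma dense_split (p q : R[i]) : (exists e : H, e != 0) -> dense_image ipK A ->
  0 <= p -> 0 <= q ->
  (forall u v, ipK (A u) (A v) = q * ipH u v + p * ipH v u) -> p = 0 \/ q = 0.
Proof.
move=> [e e0] A_dense p_ge0 q_ge0 AE.
have [-> | p0] := eqVneq p 0; first by left.
have [-> | q0] := eqVneq q 0; first by right.
exfalso.
have p_gt0 : 0 < p by rewrite lt_def p0.
have q_gt0 : 0 < q by rewrite lt_def q0.
have pq_gt0 : 0 < p + q by rewrite addr_gt0.
have N_gt0 : 0 < ipH e e by rewrite dnorm_gt0.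
(* M is the lower bound for the squared distance from y to the image. *)
pose M := p * q * ipH e e / (p + q).
have M_gt0 : 0 < M by rewrite divr_gt0 // !mulr_gt0.
have epsE : (complex.Re (sqrtC M))%:C = sqrtC M.
  by rewrite RRe_real // gtr0_real // sqrtC_gt0.
pose y := 2^-1 *: (A e - 'i *: A ('i *: e)).
have eps_gt0 : 0 < complex.Re (sqrtC M) by rewrite -ltcR epsE sqrtC_gt0.
have [v] := A_dense y _ eps_gt0.
rewrite epsE /ipnorm ltr_sqrtC ?nnegrE ?dnorm_ge0 ?(ltW M_gt0) // => lt_M.
have : 0 <= (p + q) * (ipK (A v - y) (A v - y) - M).
  suff -> : (p + q) * (ipK (A v - y) (A v - y) - M) =
      ipH ((p + q) *: v - q *: e) ((p + q) *: v - q *: e).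
    exact: dnorm_ge0.
  rewrite /y !ipE !AE !ipE rmorphD /= !(geC0_conj p_ge0) !(geC0_conj q_ge0).
  rewrite conjCi (@geC0_conj _ 2^-1) ?invr_ge0 ?ler0n // /M.
  by field: (sqrCi R[i]); rewrite gt_eqF.
rewrite pmulr_rge0 // subr_ge0 => /(lt_le_trans lt_M).
by rewrite ltxx.
Qed.
End Parts.

(** * Maps that scale the inner product *)

Section Similarity.
Variables (R : realType) (H K : lmodType R[i]).
Variables (ipH : {dot H for Num.conj}) (ipK : {dot K for Num.conj}).
Variable A : H -> K.

Lemma semilinear_additive : linear A \/ conj_linear A -> additive_map A.
Proof. by case=> Alin x y; have := Alin 1 x y; rewrite /= ?conjC1 !scale1r. Qed.

(** The squared norm of [A (a u + v) - a A u - A v] is [c] times that of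
    [(a u + v) - a u - v = 0]. *)
Lemma similarity_linear (c : R[i]) :
  (forall u v, ipK (A u) (A v) = c * ipH u v) -> linear A.
Proof.
move=> AE a u v; apply/eqP; rewrite -subr_eq0; apply/eqP/(ip_eq0 (ip := ipK)).
rewrite !ipE !AE !ipE; ring.
Qed.

Lemma similarity_conj_linear (c : R[i]) :
  (forall u v, ipK (A u) (A v) = c * ipH v u) -> conj_linear A.
Proof.
move=> AE a u v; apply/eqP; rewrite -subr_eq0; apply/eqP/(ip_eq0 (ip := ipK)).
rewrite /= !ipE !AE !ipE conjCK; ring.
Qed.

Lemma similarity_norm (c : R) : 0 < c ->
  (forall u, ipK (A u) (A u) = c%:C * ipH u u) ->
  exists g : R, 0 < g /\ forall u, ipnorm ipK (A u) = g%:C * ipnorm ipH u.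
Proof.
move=> c0 AE; exists (Num.sqrt c); split; first by rewrite sqrtr_gt0.
move=> u; rewrite /ipnorm AE rootCMl ?ler0c ?ltW //; congr (_ * _).
rewrite -[in LHS](sqr_sqrtr (ltW c0)) rmorphXn /= sqrCK // ler0c sqrtr_ge0 //.
Qed.

(** The difference of the two sides is a sesquilinear form that vanishes on the
    diagonal. *)
Lemma norm_similarity (g : R) :
  (linear A \/ conj_linear A) ->
  (forall u, ipnorm ipK (A u) = g%:C * ipnorm ipH u) ->
  (forall u v, ipK (A u) (A v) = (g ^+ 2)%:C * ipH u v) \/
  (forall u v, ipK (A u) (A v) = (g ^+ 2)%:C * ipH v u).
Proof.
move=> Alin Anorm.
have Asq u : ipK (A u) (A u) = (g ^+ 2)%:C * ipH u u.
  by rewrite -[LHS]sqrtCK -/(ipnorm ipK _) Anorm exprMn sqrtCK rmorphXn.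
have AD := semilinear_additive Alin.
have A0 : A 0 = 0 by apply: (addrI (A 0)); rewrite -AD !addr0.
case: Alin => Alin; [left | right] => u v;
  apply/eqP; rewrite -subr_eq0; apply/eqP; move: u v.
  have AZ a x : A (a *: x) = a *: A x by have := Alin a x 0; rewrite A0 !addr0.
  apply: (@sesqui_polarization _ _ _ 'i); rewrite ?neq0Ci //.
  - by move=> z x y; rewrite AD !ipE; ring.
  - by move=> z x y; rewrite AD !ipE; ring.
  - by move=> x y; rewrite AZ !ipE; ring.
  - by move=> x y; rewrite AZ !ipE conjCi; ring.
  - by move=> x; rewrite Asq subrr.
have AZ a x : A (a *: x) = a^* *: A x by have := Alin a x 0; rewrite A0 !addr0.
apply: (@sesqui_polarization _ _ _ (- 'i)); rewrite ?oppr_eq0 ?neq0Ci //.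
- by move=> z x y; rewrite AD !ipE; ring.
- by move=> z x y; rewrite AD !ipE; ring.
- by move=> x y; rewrite AZ !ipE conjCi; ring.
- by move=> x y; rewrite AZ !ipE conjCK; ring.
- by move=> x; rewrite Asq subrr.
Qed.

(** Since [A] is nonzero, the coefficient that survives is positive. *)
Lemma orth_additive_similarity :
  dim_ge H 2 -> (exists x, A x <> 0) -> dense_image ipK A ->
  additive_map A -> preserves_orth ipH ipK A ->
  exists c : R, 0 < c /\
    ((forall u v, ipK (A u) (A v) = c%:C * ipH u v) \/
     (forall u v, ipK (A u) (A v) = c%:C * ipH v u)).
Proof.
move=> dimH [x0 Ax0] A_dense AD A_orth.
have [e [_ [e0 _ _]]] := dim2_orth ipH dimH.
have A0 : A 0 = 0 by apply: (addrI (A 0)); rewrite -AD !addr0.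
pose A' : {additive H -> K} :=
  HB.pack A (GRing.isNmodMorphism.Build H K A (conj A0 AD)).
have [f [fD fE]] := ip_additive_factor (A := A') A_orth dimH.
have [|p [q [p_ge0 q_ge0 AE]]] := ip_split (A := A) _ fD fE; first by exists e.
have gt0 (c : R[i]) : 0 <= c -> (forall u, ipK (A u) (A u) = c * ipH u u) ->
    exists r : R, 0 < r /\ r%:C = c.
  move=> c_ge0 cE; have c_gt0 : 0 < c.
    rewrite lt_def c_ge0 andbT; apply/eqP => c0.
    by apply: Ax0; apply: (ip_eq0 (ip := ipK)); rewrite cE c0 mul0r.
  by exists (complex.Re c); rewrite -ltcR RRe_real // ger0_real.
have [|p0|q0] := dense_split (ipH := ipH) _ A_dense p_ge0 q_ge0 AE.
    by exists e.
  have AE' u v : ipK (A u) (A v) = q * ipH u v by rewrite AE p0 mul0r addr0.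
  have [|r [r0 rq]] := gt0 q q_ge0; first by [].
  by exists r; split=> //; left; rewrite rq.
have AE' u v : ipK (A u) (A v) = p * ipH v u by rewrite AE q0 mul0r add0r.
have [|r [r0 rq]] := gt0 p p_ge0; first by [].
by exists r; split=> //; right; rewrite rq.
Qed.

End Similarity.

Theorem theorem2p1 (R : realType) (H K : lmodType R[i])
  (ipH : {dot H for Num.conj}) (ipK : {dot K for Num.conj})
  (dimH : dim_ge H 2) (A : H -> K)
  (A_neq0 : exists x : H, A x <> 0) (A_dense : dense_image ipK A) :
  [<->
    (* (a) *)
    (linear A \/ conj_linear A) /\
      (exists gamma : R, 0 < gamma /\
         forall x : H, ipnorm ipK (A x) = gamma%:C * ipnorm ipH x);
    (* (b) *)
    exists gamma1 : R, 0 < gamma1 /\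
      ((forall x y : H, ipK (A x) (A y) = gamma1%:C * ipH x y) \/
       (forall x y : H, ipK (A x) (A y) = gamma1%:C * ipH y x));
    (* (c) *)
    (linear A \/ conj_linear A) /\ preserves_orth_both ipH ipK A;
    (* (d) *)
    (linear A \/ conj_linear A) /\ preserves_orth ipH ipK A;
    (* (e) *)
    additive_map A /\ preserves_orth_both ipH ipK A;
    (* (f) *)
    additive_map A /\ preserves_orth ipH ipK A ].
Proof.
have sim_lin (c : R) : (forall x y : H, ipK (A x) (A y) = c%:C * ipH x y) \/
    (forall x y : H, ipK (A x) (A y) = c%:C * ipH y x) ->
    linear A \/ conj_linear A.
  by case=> [/similarity_linear|/similarity_conj_linear]; [left|right].
have sim_both (c : R) : 0 < c ->
    (forall x y : H, ipK (A x) (A y) = c%:C * ipH x y) \/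
    (forall x y : H, ipK (A x) (A y) = c%:C * ipH y x) ->
    preserves_orth_both ipH ipK A.
  move=> c0; have cN0 : c%:C != 0 by rewrite gt_eqF // ltcR.
  case=> AE x y; rewrite /orth AE.
    by split=> [->|/eqP]; rewrite ?mulr0 // mulf_eq0 (negPf cN0) => /eqP.
  rewrite [ipH y x]ipC; split=> [->|/eqP]; first by rewrite conjC0 mulr0.
  by rewrite mulf_eq0 (negPf cN0) /= conjC_eq0 => /eqP.
tfae.
- case=> Alin [g [g0 Anorm]]; exists (g ^+ 2).
  split; first by rewrite exprn_gt0.
  exact: norm_similarity.
- by case=> c [c0 Asim]; split; [apply: sim_lin Asim | apply: sim_both Asim].
- by case=> Alin Aboth; split=> // x y /Aboth.
- case=> Alin Aorth; split; first exact: semilinear_additive.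
  have [c [c0 Asim]] :=
    orth_additive_similarity dimH A_neq0 A_dense
      (semilinear_additive Alin) Aorth.
  exact: sim_both Asim.
- by case=> Aadd Aboth; split=> // x y /Aboth.
- case=> Aadd Aorth.
  have [c [c0 Asim]] := orth_additive_similarity dimH A_neq0 A_dense Aadd Aorth.
  split; first exact: sim_lin Asim.
  by apply: (similarity_norm c0) => u; case: Asim => ->.
Qed.
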